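(* Let $t\in\mathbb N$, $\mathbb F_q$ of characteristic $2$, and for $i\in[t]$ let $\mathcal C_i=(C_i,\partial_i)$ be single-sector chain complexes with $n_i=\dim C_i$; let $\rho_i$ be the product-expansion of $(B_*(\mathcal C_1),\dots,B_*(\mathcal C_{i-1}),Z_*(\mathcal C_i))$. Let $$a\in\bigotimes_{i\in[t]}Z_*(\mathcal C_i)+\sum_{i\in[t]}B_*(\mathcal C_i)^{(i)}\subseteq C_1\otimes\cdots\otimes C_t,$$ and suppose there exist $z^i\in Z^*(\mathcal C_i)$, $i\in[t]$, with $\left(\bigotimes_{i\in[t]}z^i\right)\cdot a\neq0$. Then $|a|\ge\prod_{i\in[t]}(\rho_in_i)$.
   Context: Product-expansion: For codes $C_1\subseteq\mathbb F_q^{n_1},\dots,C_t\subseteq\mathbb F_q^{n_t}$, identify $\mathbb F_q^{n_1}\otimes\cdots\otimes\mathbb F_q^{n_t}$ with $t$-dimensional arrays; a direction-$i$ column is the vector in $\mathbb F_q^{n_i}$ obtained by fixing all coordinates except the $i$-th. $C^{(i)}$ is the space of arrays all of whose direction-$i$ columns lie in $C_i$, and $C_1\boxplus\cdots\boxplus C_t=C^{(1)}+\cdots+C^{(t)}$. $|c|$ is the number of nonzero entries, $|c|_i$ the number of nonzero direction-$i$ columns. The product-expansion of $(C_i)_{i\in[t]}$ is the largest $\rho\ge0$ such that every $c\in C_1\boxplus\cdots\boxplus C_t$ has a decomposition $c=c_1+\cdots+c_t$ with $c_i\in C^{(i)}$ and $|c|\ge\rho\sum_in_i|c_i|_i$.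 For a subspace $V\subseteq C_i$, $V^{(i)}$ similarly denotes arrays in $C_1\otimes\cdots\otimes C_t$ all of whose direction-$i$ columns lie in $V$. Single-sector complex: $\mathcal C=(C,\partial)$ with $C=\mathbb F_q^n$, $\partial^2=0$; $Z_*=\ker\partial$, $B_*=\operatorname{im}\partial$, $Z^*=\ker\partial^\top$. The dot product on arrays is the standard entrywise bilinear form. *)

(* Defs.v *)
From HB Require Import structures.
From mathcomp Require Import all_boot all_order all_algebra.
Import Order.TTheory GRing.Theory Num.Theory.
Local Open Scope ring_scope.

Section Arrays.
Context {F : fieldType}.

Definition idx {k : nat} (m : 'I_k -> nat) := {dffun forall j : 'I_k, 'I_(m j)}.

(* an array: an element of F^{m_0} (x) ... (x) F^{m_{k-1}} *)
Definition arr {k : nat} (m : 'I_k -> nat) := idx m -> F.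

Definition code (n : nat) := ('I_n -> F) -> Prop.

Definition upd {k : nat} {m : 'I_k -> nat} (x : idx m) (i : 'I_k) (a : 'I_(m i)) : idx m :=
  [ffun j => match i =P j with
             | ReflectT e => ecast j 'I_(m j) e a
             | ReflectF _ => x j
             end].

Definition column {k : nat} {m : 'I_k -> nat} (c : arr m) (i : 'I_k) (x : idx m)
  : 'I_(m i) -> F := fun a => c (upd x i a).

Definition wt {k : nat} {m : 'I_k -> nat} (c : arr m) : nat := #|[set x | c x != 0]|.

(* |c|_i : number of nonzero direction-i columns; each column is counted
   through its representative multi-index whose i-th coordinate is 0 *)
Definition colwt {k : nat} {m : 'I_k -> nat} (c : arr m) (i : 'I_k) : nat :=
  #|[set x : idx m | (nat_of_ord (x i) == 0%N) &&
                      [exists a : 'I_(m i), column c i x a != 0]]|.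

Definition in_dir {k : nat} {m : 'I_k -> nat} (C : forall j : 'I_k, code (m j))
  (i : 'I_k) (c : arr m) : Prop :=
  forall x : idx m, C i (column c i x).

Definition is_sum {k : nat} {m : 'I_k -> nat} (c : arr m) (cs : 'I_k -> arr m) : Prop :=
  forall x, c x = \sum_(j < k) cs j x.

Definition in_boxplus {k : nat} {m : 'I_k -> nat} (C : forall j : 'I_k, code (m j))
  (c : arr m) : Prop :=
  exists cs : 'I_k -> arr m, (forall j, in_dir C j (cs j)) /\ is_sum c cs.

Context {R : realFieldType}.

Definition expands {k : nat} {m : 'I_k -> nat} (C : forall j : 'I_k, code (m j)) (rho : R)
  : Prop :=
  forall c : arr m, in_boxplus C c ->
    exists cs : 'I_k -> arr m,
      [/\ forall j, in_dir C j (cs j), is_sum c cs &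
          rho * (\sum_(j < k) (m j * colwt (cs j) j)%:R) <= (wt c)%:R].

Definition is_product_expansion {k : nat} {m : 'I_k -> nat}
  (C : forall j : 'I_k, code (m j)) (rho : R) : Prop :=
  [/\ 0 <= rho, expands C rho &
      forall rho', 0 <= rho' -> expands C rho' -> rho' <= rho].

(* single-sector complex (F^n, d) with d a square matrix acting on column
   vectors: (d v)_r = sum_s d r s * v s *)
Definition Zlow {n : nat} (d : 'M[F]_n) : code n :=
  fun v => forall r : 'I_n, \sum_(s < n) d r s * v s = 0.
Definition Blow {n : nat} (d : 'M[F]_n) : code n :=
  fun v => exists u : 'I_n -> F, forall r : 'I_n, v r = \sum_(s < n) d r s * u s.
Definition Zup {n : nat} (d : 'M[F]_n) : code n :=
  fun w => forall s : 'I_n, \sum_(r < n) d r s * w r = 0.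

(* the tensor product C_1 (x) ... (x) C_k as the span of pure tensors *)
Definition in_tensor {k : nat} {m : 'I_k -> nat} (C : forall j : 'I_k, code (m j))
  (c : arr m) : Prop :=
  exists s : seq (forall j : 'I_k, 'I_(m j) -> F),
    (forall i : 'I_(size s), forall j, C j (nth (fun j _ => 0) s i j)) /\
    forall x : idx m, c x = \sum_(i < size s) \prod_(j < k) nth (fun j _ => 0) s i j (x j).

Definition dot_pure {k : nat} {m : 'I_k -> nat} (z : forall j : 'I_k, 'I_(m j) -> F)
  (a : arr m) : F :=
  \sum_(x : idx m) (\prod_(j < k) z j (x j)) * a x.

End Arrays.

Definition prefix_ord {t : nat} (i : 'I_t) (j : 'I_i.+1) : 'I_t :=
  widen_ord (ltn_ord i) j.

(* Main.v *)
Require Import Defs.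
From HB Require Import structures.
From mathcomp Require Import all_boot all_order all_algebra.
From Stdlib Require Import FunctionalExtensionality.
From mathcomp Require Import ring.
Import Order.TTheory GRing.Theory Num.Theory.
Local Open Scope ring_scope.
Set Implicit Arguments. Unset Strict Implicit. Unset Printing Implicit Defensive.

(* Since B_i is contained in Z_i, a lies in
   B_1^(1) + ... + B_(t-1)^(t-1) + Z_t^(t), so the product-expansion rho_t splits
   a = c_1 + ... + c_t with rho_t n_t |c_t|_t <= |a|.  Every z^i annihilates the
   direction-i columns of boundaries, so (z^1 x ... x z^t).a = (z^1 x ... x z^t).c_t.
   Contracting c_t against z^t in the last direction gives a (t-1)-dimensional
   array a' with |a'| <= |c_t|_t, paired nontrivially with z^1 x ... x z^(t-1), and
   again a sum of an array with cycle columns in every direction and boundaries;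
   the induction hypothesis gives |a'| >= (rho_1 n_1) ... (rho_(t-1) n_(t-1)). *)

Section Codes.
Variable F : fieldType.

Definition lin_closed n (C : @code F n) : Prop :=
  [/\ C (fun _ => 0), forall u v, C u -> C v -> C (fun r => u r + v r) &
      forall c u, C u -> C (fun r => c * u r)].

Lemma code_ext n (C : @code F n) (u v : 'I_n -> F) : C u -> u =1 v -> C v.
Proof. by move=> Cu /functional_extensionality <-. Qed.

Lemma lin_closed_sum n (C : @code F n) (I : finType) (u : I -> 'I_n -> F) :
  lin_closed C -> (forall i, C (u i)) -> C (fun r => \sum_i u i r).
Proof.
case=> C0 CD _ Cu; elim: (index_enum I) => [|i s IH].
  by apply: code_ext C0 _ => r; rewrite big_nil.
by apply: code_ext (CD _ _ (Cu i) IH) _ => r; rewrite big_cons.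
Qed.

Lemma lin_closed_comb n (C : @code F n) (I : finType) (c : I -> F) (u : I -> 'I_n -> F) :
  lin_closed C -> (forall i, C (u i)) -> C (fun r => \sum_i c i * u i r).
Proof.
move=> linC Cu; apply: (lin_closed_sum (u := fun i r => c i * u i r)) => // i.
by case: linC => _ _ CZ; apply: CZ.
Qed.

Lemma lin_closedB n (C : @code F n) u v :
  lin_closed C -> C u -> C v -> C (fun r => u r - v r).
Proof.
case=> _ CD CZ Cu Cv; apply: (code_ext (CD _ _ Cu (CZ (-1) _ Cv))) => r.
by rewrite mulN1r.
Qed.

Lemma lin_closed_Zlow n (d : 'M[F]_n) : lin_closed (Zlow d).
Proof.
split.
- by move=> r; rewrite big1 // => s _; rewrite mulr0.
- move=> u v Zu Zv r; under eq_bigr do rewrite mulrDr.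
  by rewrite big_split /= Zu Zv addr0.
- move=> c u Zu r; under eq_bigr do rewrite mulrCA.
  by rewrite -mulr_sumr Zu mulr0.
Qed.

Lemma lin_closed_Blow n (d : 'M[F]_n) : lin_closed (Blow d).
Proof.
split.
- by exists (fun _ => 0) => r; rewrite big1 // => s _; rewrite mulr0.
- move=> u v [u' Hu] [v' Hv]; exists (fun s => u' s + v' s) => r.
  by under eq_bigr do rewrite mulrDr; rewrite big_split /= Hu Hv.
- move=> c u [u' Hu]; exists (fun s => c * u' s) => r.
  by under eq_bigr do rewrite mulrCA; rewrite -mulr_sumr Hu.
Qed.

Lemma Blow_Zlow n (d : 'M[F]_n) v : d *m d = 0 -> Blow d v -> Zlow d v.
Proof.
move=> dd [u Hu] r; under eq_bigr do rewrite Hu mulr_sumr.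
rewrite exchange_big /= big1 // => l _.
have : (d *m d) r l = 0 by rewrite dd mxE.
rewrite mxE => ddrl; rewrite -[RHS](mul0r (u l)) -[in RHS]ddrl mulr_suml.
by apply: eq_bigr => s _; rewrite mulrA.
Qed.

Lemma Zup_Blow_orth n (d : 'M[F]_n) w v :
  Zup d w -> Blow d v -> \sum_(r < n) w r * v r = 0.
Proof.
move=> Zw [u Hu]; under eq_bigr do rewrite Hu mulr_sumr.
rewrite exchange_big /= big1 // => s _.
rewrite -[RHS](mul0r (u s)) -[in RHS](Zw s) mulr_suml; apply: eq_bigr => r _.
by rewrite mulrA [w r * _]mulrC.
Qed.

End Codes.

Section Arrays.
Variables (F : fieldType) (k : nat) (m : 'I_k -> nat).

Lemma upd_at (x : idx m) i a : upd x i a i = a.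
Proof.
rewrite /upd ffunE; case: eqP => // e.
by rewrite (eq_irrelevance e erefl).
Qed.

Lemma upd_other (x : idx m) i a j : i != j -> upd x i a j = x j.
Proof. by rewrite /upd ffunE; case: eqP. Qed.

Lemma upd_id (x : idx m) i : upd x i (x i) = x.
Proof.
apply/ffunP => j; case: (eqVneq i j) => [<-|ij]; first by rewrite upd_at.
by rewrite upd_other.
Qed.

Lemma upd_upd (x : idx m) i a b : upd (upd x i a) i b = upd x i b.
Proof.
apply/ffunP => j; case: (eqVneq i j) => [<-|ij]; first by rewrite !upd_at.
by rewrite !upd_other.
Qed.

Lemma in_tensor_in_dir (C : forall j, @code F (m j)) (a : arr m) j :
  (forall j, lin_closed (C j)) -> in_tensor C a -> in_dir C j a.
Proof.
move=> linC [s [Cs aE]] x.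
pose c (i : 'I_(size s)) := \prod_(l | l != j) nth (fun j _ => 0) s i l (x l).
apply: (code_ext (lin_closed_comb c (u := fun i => nth (fun j _ => 0) s i j)
  (linC j) (Cs^~ j))) => r.
rewrite /column aE; apply: eq_bigr => i _.
rewrite (bigD1 j) //= upd_at mulrC; congr (_ * _).
by apply: eq_bigr => l lj; rewrite upd_other // eq_sym.
Qed.

Lemma dot_pure_sum (z : forall j, 'I_(m j) -> F) (a : arr m) (cs : 'I_k -> arr m) :
  is_sum a cs -> dot_pure z a = \sum_j dot_pure z (cs j).
Proof.
move=> acs; rewrite /dot_pure; under eq_bigr do rewrite acs mulr_sumr.
exact: exchange_big.
Qed.

(* Fibre the sum over the direction-j columns and pair each column with z j. *)
Lemma dot_pure_col_orth (z : forall j, 'I_(m j) -> F) (c : arr m) j :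
  (forall x, \sum_r z j r * column c j x r = 0) -> dot_pure z c = 0.
Proof.
move=> orth; rewrite /dot_pure.
case: (pickP (@predT 'I_(m j))) => [r0 _|empty]; last first.
  by rewrite big1 // => y _; have := empty (y j).
rewrite (partition_big (fun y => upd y j r0) (fun x : idx m => x j == r0)) /=;
  last by move=> y _; rewrite upd_at.
rewrite big1 // => x /eqP xj.
rewrite (reindex_onto (upd x j) (fun y : idx m => y j)) /=; last first.
  by move=> y /eqP <-; rewrite upd_upd upd_id.
rewrite (eq_bigl xpredT); last by move=> r; rewrite upd_upd -xj upd_id upd_at !eqxx.
rewrite -[RHS](mulr0 (\prod_(l | l != j) z l (x l))) -[in RHS](orth x) mulr_sumr.
apply: eq_bigr => r _; rewrite (bigD1 j) //= upd_at /column.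
rewrite (eq_bigr (fun l => z l (x l))); last by move=> l lj; rewrite upd_other // eq_sym.
by rewrite mulrCA mulrA.
Qed.

Lemma dot_pure_wt_gt0 (z : forall j, 'I_(m j) -> F) (a : arr m) :
  dot_pure z a != 0 -> (0 < wt a)%N.
Proof.
move=> za; have /existsP[x] : [exists x : idx m, (\prod_j z j (x j)) * a x != 0].
  apply: contraR za => /existsPn za; apply/eqP.
  by rewrite /dot_pure big1 // => x _; apply/eqP/negbNE.
by move=> zax; apply/card_gt0P; exists x; rewrite inE; apply: contra zax => /eqP->; rewrite mulr0.
Qed.

Lemma expansion_colwt_le (R : numDomainType) (rho : R) (c : @arr F _ m) (cs : 'I_k -> @arr F _ m) j :
  0 <= rho -> rho * (\sum_i (m i * colwt (cs i) i)%:R) <= (wt c)%:R ->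
  rho * (m j * colwt (cs j) j)%:R <= (wt c)%:R.
Proof.
move=> rho0; apply: le_trans; rewrite ler_wpM2l // (bigD1 j) //= lerDl.
by apply: sumr_ge0 => i _; rewrite ler0n.
Qed.

End Arrays.

Section LastDirection.
Variables (F : fieldType) (k : nat) (f : nat -> nat).
Local Notation mS := (fun i : 'I_k.+1 => f i).
Local Notation m' := (fun i : 'I_k => f i).
Local Notation widen := (widen_ord (leqnSn k)).

Definition restr (y : idx mS) : idx m' := [ffun j => y (widen j)].

Lemma f_last (j : 'I_k.+1) : (k <= j)%N -> f k = f j.
Proof. by move=> kj; congr f; apply/eqP; rewrite eqn_leq kj -ltnS ltn_ord. Qed.

Definition ext (x : idx m') (a : 'I_(f k)) : idx mS :=
  [ffun j : 'I_k.+1 => match ltnP j k with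
                       | LtnNotGeq jk => x (Ordinal jk)
                       | GeqNotLtn kj => cast_ord (f_last kj) a
                       end].

Lemma ext_widen x a (j : 'I_k) : ext x a (widen j) = x j.
Proof.
rewrite ffunE; case: ltnP => jk; last by have := ltn_ord j; rewrite ltnNge jk.
by case: j jk => j jk' jk /=; rewrite (bool_irrelevance jk jk').
Qed.

Lemma ext_max x a : ext x a ord_max = a.
Proof.
rewrite ffunE; case: ltnP => kk; first by have := kk; rewrite ltnn.
exact: val_inj.
Qed.

Lemma restr_ext x a : restr (ext x a) = x.
Proof. by apply/ffunP => j; rewrite ffunE ext_widen. Qed.

Lemma ext_restr y : ext (restr y) (y ord_max) = y.
Proof.
apply/ffunP => j; rewrite ffunE; case: ltnP => jk.
  rewrite ffunE; case: j jk => j jk' jk /=.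
  by rewrite /widen_ord /= (bool_irrelevance (widen_ord_proof (Ordinal jk) (leqnSn k)) jk').
apply: val_inj => /=.
by have -> : j = ord_max by apply: val_inj; apply/eqP; rewrite /= eqn_leq jk -ltnS ltn_ord.
Qed.

Lemma idx_last_eq (y1 y2 : idx mS) :
  restr y1 = restr y2 -> y1 ord_max = y2 ord_max -> y1 = y2.
Proof. by move=> e1 e2; rewrite -(ext_restr y1) -(ext_restr y2) e1 e2. Qed.

Lemma upd_ext_max x a b : upd (ext x a) ord_max b = ext x b.
Proof.
apply: idx_last_eq; last by rewrite upd_at ext_max.
apply/ffunP => j; rewrite [LHS]ffunE [RHS]ffunE upd_other ?ext_widen //.
by rewrite neq_ltn /= ltn_ord orbT.
Qed.

Lemma ext_upd x (j : 'I_k) u a : ext (upd x j u) a = upd (ext x a) (widen j) u.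
Proof.
apply: idx_last_eq; last by rewrite ext_max upd_other ?ext_max // neq_ltn /= ltn_ord.
apply/ffunP => l; rewrite [LHS]ffunE [RHS]ffunE ext_widen.
by case: (eqVneq j l) => [<-|jl]; rewrite ?upd_at // !upd_other ?ext_widen.
Qed.

Lemma sum_idx_last (G : idx mS -> F) :
  \sum_y G y = \sum_(x : idx m') \sum_(a : 'I_(f k)) G (ext x a).
Proof.
rewrite pair_big /= (reindex (fun p : idx m' * 'I_(f k) => ext p.1 p.2)) //=.
exists (fun y => (restr y, y ord_max)) => [[x a] _|y _] /=.
  by rewrite restr_ext ext_max.
exact: ext_restr.
Qed.

Definition contract (zk : 'I_(f k) -> F) (c : @arr F _ mS) : @arr F _ m' :=
  fun x => \sum_a zk a * c (ext x a).

Lemma contract_ext zk c1 c2 : c1 =1 c2 -> contract zk c1 =1 contract zk c2.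
Proof. by move=> e x; apply: eq_bigr => a _; rewrite e. Qed.

Lemma contractD zk c1 c2 x :
  contract zk (fun y => c1 y + c2 y) x = contract zk c1 x + contract zk c2 x.
Proof. by rewrite /contract -big_split; apply: eq_bigr => a _; rewrite mulrDr. Qed.

Lemma contract_sum zk (cs : 'I_k -> arr mS) x :
  contract zk (fun y => \sum_j cs j y) x = \sum_j contract zk (cs j) x.
Proof. by rewrite /contract exchange_big; apply: eq_bigr => a _; rewrite mulr_sumr. Qed.

Lemma contract_col_orth zk c :
  (forall y, \sum_a zk a * column c ord_max y a = 0) -> forall x, contract zk c x = 0.
Proof.
move=> orth x; case: (pickP (@predT 'I_(f k))) => [a0 _|empty]; last first.
  by rewrite /contract big1 // => a; have := empty a.
by rewrite -(orth (ext x a0)); apply: eq_bigr => a _; rewrite /column upd_ext_max.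
Qed.

Lemma contract_in_dir (C : forall j : 'I_k.+1, code (f j)) zk c (j : 'I_k) :
  lin_closed (C (widen j)) -> in_dir C (widen j) c ->
  in_dir (fun j : 'I_k => C (widen j)) j (contract zk c).
Proof.
move=> linC Cc x; apply: (code_ext (lin_closed_comb zk linC (fun a => Cc (ext x a)))) => u.
by apply: eq_bigr => a _; rewrite /column ext_upd.
Qed.

Lemma dot_pure_contract (z : forall i : 'I_k.+1, 'I_(f i) -> F) c :
  dot_pure (fun i : 'I_k => z (widen i)) (contract (z ord_max) c) = dot_pure z c.
Proof.
rewrite /dot_pure sum_idx_last; apply: eq_bigr => x _.
rewrite mulr_sumr; apply: eq_bigr => a _.
rewrite big_ord_recr /= ext_max mulrA; congr (_ * _ * _).
by apply: eq_bigr => i _; rewrite ext_widen.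
Qed.

Lemma wt_contract zk c : (wt (contract zk c) <= colwt c ord_max)%N.
Proof.
apply: leq_trans (leq_imset_card restr _); apply: subset_leq_card.
apply/subsetP => x; rewrite inE => cx.
have /existsP[a ca] : [exists a, zk a * c (ext x a) != 0].
  by apply: contraR cx => /existsPn cx; apply/eqP/big1 => a _; apply/eqP/negbNE.
have f0 : (0 < f k)%N by apply: leq_ltn_trans (ltn_ord a).
apply/imsetP; exists (ext x (Ordinal f0)); last by rewrite restr_ext.
rewrite inE ext_max eqxx /=; apply/existsP; exists a.
by rewrite /column upd_ext_max; apply: contra ca => /eqP->; rewrite mulr0.
Qed.

End LastDirection.

Section Induction.
Variables (F : fieldType) (R : realFieldType).

Definition bdry_cycle_codes k (m : 'I_k.+1 -> nat) (d : forall i, 'M[F]_(m i)) :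
  forall j, code (m j) :=
  fun j => if (j < k)%N then Blow (d j) else Zlow (d j).

Definition prefix_expansions k (m : 'I_k -> nat) (d : forall i, 'M[F]_(m i))
  (rho : 'I_k -> R) : Prop :=
  forall i : 'I_k, is_product_expansion (bdry_cycle_codes (fun j => d (prefix_ord i j))) (rho i).

Definition cycles_plus_boundaries k (m : 'I_k -> nat) (d : forall i, 'M[F]_(m i))
  (a : arr m) : Prop :=
  exists a0 (b : 'I_k -> arr m),
    [/\ forall j, in_dir (fun i => Zlow (d i)) j a0,
        forall i, in_dir (fun i => Blow (d i)) i (b i) &
        forall x, a x = a0 x + \sum_i b i x].

Definition detected_by_cocycles k (m : 'I_k -> nat) (d : forall i, 'M[F]_(m i))
  (a : arr m) : Prop :=
  exists z : forall i, 'I_(m i) -> F, (forall i, Zup (d i) (z i)) /\ dot_pure z a != 0.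

Section Step.
Variables (k : nat) (f : nat -> nat) (d : forall i : 'I_k.+1, 'M[F]_(f i)).
Local Notation widen := (widen_ord (leqnSn k)).

Lemma d_ord_irr j (lt1 lt2 : (j < k.+1)%N) : d (Ordinal lt1) = d (Ordinal lt2).
Proof. by rewrite (bool_irrelevance lt1 lt2). Qed.

Lemma expansion_last (rho : 'I_k.+1 -> R) :
  prefix_expansions d rho -> is_product_expansion (bdry_cycle_codes d) (rho ord_max).
Proof.
move/(_ ord_max); congr is_product_expansion.
apply: functional_extensionality_dep => -[j lt_jk].
by rewrite /bdry_cycle_codes /prefix_ord /widen_ord /= [in LHS](d_ord_irr _ lt_jk).
Qed.

Lemma prefix_expansions_widen (rho : 'I_k.+1 -> R) :
  prefix_expansions d rho ->
  prefix_expansions (fun i : 'I_k => d (widen i)) (fun i => rho (widen i)).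
Proof.
move=> exp_d i; have := exp_d (widen i); congr is_product_expansion.
apply: functional_extensionality_dep => -[j lt_ji].
have lt_jk : (j < k.+1)%N := leq_trans lt_ji (ltn_ord (widen i)).
by rewrite /bdry_cycle_codes /prefix_ord /widen_ord /= [in LHS](d_ord_irr _ lt_jk)
  [in RHS](d_ord_irr _ lt_jk).
Qed.

Lemma in_dir_bdry_cycle_codes c (j : 'I_k) :
  in_dir (bdry_cycle_codes d) (widen j) c -> in_dir (fun i => Blow (d i)) (widen j) c.
Proof. by move=> Cc y; have := Cc y; rewrite /bdry_cycle_codes /= ltn_ord. Qed.

Lemma in_boxplus_last (a : arr (fun i : 'I_k.+1 => f i)) :
  (forall i, d i *m d i = 0) -> cycles_plus_boundaries d a ->
  in_boxplus (bdry_cycle_codes d) a.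
Proof.
move=> dd [a0 [b [a0Z bB ab]]].
exists (fun j : 'I_k.+1 => if (j < k)%N then b j else fun y => a0 y + b j y); split.
- move=> j y; rewrite /bdry_cycle_codes; case: ifP => _; first exact: bB.
  have [_ ZD _] := lin_closed_Zlow (d j).
  exact: ZD (a0Z j y) (Blow_Zlow (dd j) (bB j y)).
- move=> y; rewrite ab [RHS]big_ord_recr [in LHS]big_ord_recr /= ltnn.
  rewrite [in RHS](eq_bigr (fun i => b (widen i) y)) => [|i _]; last by rewrite ltn_ord.
  by rewrite addrCA addrA.
Qed.

Lemma contract_cycles_plus_boundaries (a : arr (fun i : 'I_k.+1 => f i)) cs zk :
  cycles_plus_boundaries d a ->
  (forall j, in_dir (bdry_cycle_codes d) j (cs j)) -> is_sum a cs ->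
  Zup (d ord_max) zk ->
  cycles_plus_boundaries (fun i : 'I_k => d (widen i)) (contract zk (cs ord_max)).
Proof.
move=> [a0 [b [a0Z bB ab]]] cs_dir acs Zzk.
have csE y : cs ord_max y =
    a0 y + \sum_(j < k) (b (widen j) y - cs (widen j) y) + b ord_max y.
  have := acs y; rewrite ab !big_ord_recr /= sumrB => E.
  rewrite -[cs _ _](addKr (\sum_(j < k) cs (widen j) y)) addrC -E; ring.
exists (contract zk a0), (fun j => contract zk (fun y => b (widen j) y - cs (widen j) y)).
split.
- move=> j; apply: (contract_in_dir (C := fun i => Zlow (d i))) (a0Z _).
  exact: lin_closed_Zlow.
- move=> j; apply: (contract_in_dir (C := fun i => Blow (d i))) => [|y].
    exact: lin_closed_Blow.
  exact: lin_closedB (lin_closed_Blow _) (bB _ y) (in_dir_bdry_cycle_codes (cs_dir _) y).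
- move=> x; rewrite (contract_ext zk csE) !contractD contract_sum.
  rewrite (contract_col_orth (c := b ord_max)) ?addr0 // => y.
  exact: Zup_Blow_orth Zzk (bB ord_max y).
Qed.

Lemma detected_contract (a : arr (fun i : 'I_k.+1 => f i)) cs z :
  (forall j, in_dir (bdry_cycle_codes d) j (cs j)) -> is_sum a cs ->
  (forall i, Zup (d i) (z i)) -> dot_pure z a != 0 ->
  detected_by_cocycles (fun i : 'I_k => d (widen i)) (contract (z ord_max) (cs ord_max)).
Proof.
move=> cs_dir acs Zz za; exists (fun i => z (widen i)); split=> [i|]; first exact: Zz.
rewrite dot_pure_contract; move: za; rewrite (dot_pure_sum _ acs) big_ord_recr /=.
rewrite big1 ?add0r // => j _; apply: (dot_pure_col_orth (j := widen j)) => y.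
exact: Zup_Blow_orth (Zz _) (in_dir_bdry_cycle_codes (cs_dir _) y).
Qed.

End Step.

Lemma prod_expansion_le_wt k (f : nat -> nat) (d : forall i : 'I_k, 'M[F]_(f i))
    (rho : 'I_k -> R) (a : arr (fun i : 'I_k => f i)) :
  (forall i, d i *m d i = 0) -> prefix_expansions d rho ->
  cycles_plus_boundaries d a -> detected_by_cocycles d a ->
  \prod_(i < k) (rho i * (f i)%:R) <= (wt a)%:R.
Proof.
elim: k f d rho a => [|k IH] f d rho a dd exp_d Ha [z [Zz za]].
  by rewrite big_ord0 ler1n; apply: dot_pure_wt_gt0 za.
have [rho_ge0 expands_last _] := expansion_last exp_d.
have [cs [cs_dir acs le_wt]] := expands_last a (in_boxplus_last dd Ha).
have := IH f _ _ _ (fun i => dd (widen_ord (leqnSn k) i)) (prefix_expansions_widen exp_d)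
  (contract_cycles_plus_boundaries Ha cs_dir acs (Zz ord_max))
  (detected_contract cs_dir acs Zz za).
rewrite big_ord_recr /= mulrC => le_wt'.
have rn_ge0 : 0 <= rho ord_max * (f k)%:R by rewrite mulr_ge0 ?ler0n.
apply: le_trans (ler_wpM2l rn_ge0 le_wt') _.
apply: le_trans (expansion_colwt_le ord_max rho_ge0 le_wt).
by rewrite natrM mulrA ler_wpM2l // ler_nat wt_contract.
Qed.

End Induction.

Theorem lemma4p6 (F : finFieldType) (R : realFieldType) (t : nat)
  (n : 'I_t -> nat) (d : forall i : 'I_t, 'M[F]_(n i)) (rho : 'I_t -> R) :
  (2%N \in [pchar F]) ->
  (forall i : 'I_t, d i *m d i = 0) ->
  (forall i : 'I_t,
     is_product_expansion (m := fun j : 'I_i.+1 => n (prefix_ord i j))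
       (fun j : 'I_i.+1 => if (j < i)%N then Blow (d (prefix_ord i j))
                           else Zlow (d (prefix_ord i j)))
       (rho i)) ->
  forall a : arr n,
  (exists (a0 : arr n) (b : 'I_t -> arr n),
      [/\ in_tensor (fun i => Zlow (d i)) a0,
          forall i : 'I_t, in_dir (fun i => Blow (d i)) i (b i) &
          forall x : idx n, a x = a0 x + \sum_(i < t) b i x]) ->
  (exists z : forall i : 'I_t, 'I_(n i) -> F,
      (forall i : 'I_t, Zup (d i) (z i)) /\ dot_pure z a != 0) ->
  \prod_(i < t) (rho i * (n i)%:R) <= (wt a)%:R.
Proof.
move=> _ dd exp_d a [a0 [b [a0Z bB ab]]] detected.
(* Side lengths given by a function on nat restrict to the first directions
   convertibly, which the induction relies on. *)
have [f En] : exists f : nat -> nat, n = (fun i => f i).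
  exists (fun j => if insub j is Some i then n i else 0%N).
  by apply: functional_extensionality => i; rewrite valK.
subst n; apply: prod_expansion_le_wt dd exp_d _ detected.
exists a0, b; split=> // j; apply: in_tensor_in_dir a0Z => i.
exact: lin_closed_Zlow.
Qed.
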